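(* Let $\delta_0>0$ be a sufficiently small constant and $d_0=\lfloor\delta_0\ln n\rfloor$. Let $G=(V,E)$ be a graph on vertex set $V=[n]$ satisfying properties (P1)–(P6) below. Form a random spanning subgraph $\Gamma_0$ of $G$ as follows: for every $v\in V\setminus SMALL(G)$, choose a set $E(v)$ of $d_0$ edges of $G$ incident to $v$ uniformly at random (independently for different $v$); for every $v\in SMALL(G)$, let $E(v)$ be the set of all edges of $G$ incident to $v$; set $E(\Gamma_0)=\bigcup_v E(v)$. Then with probability (over the choices of the sets $E(v)$) tending to $1$ as $n\to\infty$, $\Gamma_0$ is an $(n/4,2)$-expander with at most $d_0n$ edges. The properties are: (P1) $\Delta(G)\le 10\ln n$ and $\delta(G)\ge 2$; (P2) $|SMALL(G)|\le n^{0.3}$; (P3) $G$ does not contain a non-empty path of length at most $4$ both of whose (possibly identical) endpoints lie in $SMALL(G)$; (P4) every vertex subset $U\subset[n]$ with $|U|\le \frac{n}{\ln^{1/2}n}$ spans at most $|U|\ln^{3/4}n$ edges of $G$; (P5) for every pair of disjoint vertex subsets $U,W$ with $|U|\le\frac{n}{\ln^{1/2}n}$ and $|W|\le |U|\ln^{1/4}n$, the number of edges of $G$ between $U$ and $W$ is at most $\frac{d_0|U|}{2}$; (P6) for every pair of disjoint vertex subsets $U,W$ with $|U|=|W|=\left\lceil\frac{n}{\ln^{1/2}n}\right\rceil$, $G$ has at least $0.5n$ edges between $U$ and $W$.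
   Context: For a graph $G$ on $n$ vertices, $SMALL(G)=\{v\in V(G): d_G(v)<d_0\}$. $\Delta(G)$ and $\delta(G)$ denote maximum and minimum degree. Path lengths are measured in edges. For a positive integer $k$ and a positive real $\alpha$, a graph $\Gamma=(V,E)$ is a $(k,\alpha)$-expander if $|N_\Gamma(U)|\ge\alpha|U|$ for every $U\subset V$ with $|U|\le k$, where $N_\Gamma(U)=\{v\in V\setminus U: v\text{ has a neighbor in }U\}$. *)

(* Defs.v *)
From HB Require Import structures.
From mathcomp Require Import all_boot all_order all_algebra.
From mathcomp Require Import reals exp.

Set Implicit Arguments.
Unset Strict Implicit.
Unset Printing Implicit Defensive.
Import Order.TTheory GRing.Theory Num.Theory.
Local Open Scope ring_scope.

(* A graph on the finite vertex type T is given by its set of edges, an edge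
   being a two-element set of vertices. *)
Definition simple_graph (T : finType) (E : {set {set T}}) : bool :=
  [forall e in E, #|e| == 2%N].

Definition adj (T : finType) (E : {set {set T}}) : rel T :=
  fun x y => [set x; y] \in E.

Definition incident (T : finType) (E : {set {set T}}) (v : T) : {set {set T}} :=
  [set e in E | v \in e].

Definition degree (T : finType) (E : {set {set T}}) (v : T) : nat :=
  #|incident E v|.

Definition nbhd (T : finType) (E : {set {set T}}) (U : {set T}) : {set T} :=
  [set v in ~: U | [exists u in U, adj E u v]].

Definition edges_in (T : finType) (E : {set {set T}}) (U : {set T}) :
    {set {set T}} :=
  [set e in E | e \subset U].

Definition edges_between (T : finType) (E : {set {set T}}) (U W : {set T}) :
    {set {set T}} :=
  [set e in E | [exists u in U, [exists w in W, e == [set u; w]]]].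

Definition small (T : finType) (E : {set {set T}}) (d : nat) : {set T} :=
  [set v | (degree E v < d)%N].

(* x :: p lists the vertices of a path with size p edges.  Its vertices are
   pairwise distinct, except that the two endpoints may coincide, in which case
   the path is a cycle (so that going back and forth along one edge is not a
   path). *)
Definition graph_path (T : finType) (E : {set {set T}}) (x : T) (p : seq T) :
    bool :=
  path (adj E) x p &&
  (uniq (x :: p) || [&& last x p == x, uniq p & (3 <= size p)%N]).

(* k is allowed to be real, so that n / 4 needs no rounding. *)
Definition expander (R : realType) (T : finType) (E : {set {set T}})
    (k alpha : R) : bool :=
  [forall U : {set T},
     (#|U|%:R <= k) ==> (alpha * #|U|%:R <= #|nbhd E U|%:R)].

Definition lnpow (R : realType) (n : nat) (a : R) : R := powR (ln n%:R) a.

Definition d0 (R : realType) (delta0 : R) (n : nat) : nat :=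
  Num.truncn (delta0 * ln n%:R).

Definition P1 (R : realType) (n : nat) (G : {set {set 'I_n}}) : Prop :=
  forall v : 'I_n, (degree G v)%:R <= 10 * ln n%:R :> R /\ (2 <= degree G v)%N.

Definition P2 (R : realType) (delta0 : R) (n : nat) (G : {set {set 'I_n}}) :
    Prop :=
  #|small G (d0 delta0 n)|%:R <= powR n%:R (3 / 10) :> R.

Definition P3 (R : realType) (delta0 : R) (n : nat) (G : {set {set 'I_n}}) :
    Prop :=
  ~ exists (x : 'I_n) (p : seq 'I_n),
      [/\ graph_path G x p, (1 <= size p <= 4)%N,
          x \in small G (d0 delta0 n) & last x p \in small G (d0 delta0 n)].

Definition P4 (R : realType) (n : nat) (G : {set {set 'I_n}}) : Prop :=
  forall U : {set 'I_n},
    #|U|%:R <= n%:R / lnpow n (1 / 2 : R) ->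
    #|edges_in G U|%:R <= #|U|%:R * lnpow n (3 / 4 : R).

Definition P5 (R : realType) (delta0 : R) (n : nat) (G : {set {set 'I_n}}) :
    Prop :=
  forall U W : {set 'I_n}, [disjoint U & W] ->
    #|U|%:R <= n%:R / lnpow n (1 / 2 : R) ->
    #|W|%:R <= #|U|%:R * lnpow n (1 / 4 : R) ->
    #|edges_between G U W|%:R <= (d0 delta0 n)%:R * #|U|%:R / 2 :> R.

Definition P6 (R : realType) (n : nat) (G : {set {set 'I_n}}) : Prop :=
  forall U W : {set 'I_n}, [disjoint U & W] ->
    #|U|%:Z = Num.ceil (n%:R / lnpow n (1 / 2 : R)) ->
    #|W|%:Z = Num.ceil (n%:R / lnpow n (1 / 2 : R)) ->
    n%:R / 2 <= #|edges_between G U W|%:R :> R.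

Definition choices (T : finType) (E : {set {set T}}) (d : nat) (v : T) :
    {set {set {set T}}} :=
  if v \in small E d then [set incident E v]
  else [set A in powerset (incident E v) | #|A| == d].

Definition uniform (R : realType) (T : finType) (A : {set T}) (x : T) : R :=
  if x \in A then #|A|%:R^-1 else 0.

(* Joint law of the independent family (E(v))_v, each E(v) being uniform on
   choices E d v. *)
Definition choice_law (R : realType) (T : finType) (E : {set {set T}}) (d : nat)
    (X : {ffun T -> {set {set T}}}) : R :=
  \prod_(v : T) uniform R (choices E d v) (X v).

Definition choice_prob (R : realType) (T : finType) (E : {set {set T}})
    (d : nat) (A : pred {ffun T -> {set {set T}}}) : R :=
  \sum_(X | A X) choice_law R E d X.

Definition Gamma0 (T : finType) (X : {ffun T -> {set {set T}}}) :
    {set {set T}} :=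
  \bigcup_(v : T) X v.

(* Main.v *)
Require Import Defs.
From HB Require Import structures.
From mathcomp Require Import all_boot all_order all_algebra.
From mathcomp Require Import reals sequences exp zify ring lra.

Set Implicit Arguments.
Unset Strict Implicit.
Unset Printing Implicit Defensive.
Import Order.TTheory GRing.Theory Num.Theory.
Local Open Scope ring_scope.

(** Write L = ln n and s = ceil(n / L^(1/2)).

    Sets U with |U| <= n / L^(1/2) expand for every choice of the E(v).  Let U1
    be the part of U inside SMALL and U2 the rest.  Double counting the edges of
    Gamma0 at U2 against (P4) and (P5) gives |N(U2)| >= 4|U2|.  By (P3) the
    neighbourhoods of the vertices of U1 are disjoint, so |N(U1)| >= 2|U1|, and
    each vertex of U2 accounts for at most one vertex of N(U1) inside
    U2 :|: N(U2) and for at most one vertex of N(U2) inside U1; hence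
    |N(U)| >= 2|U1| + |N(U2)| - 2|U2| >= 2|U|.

    Larger sets expand as soon as Gamma0 has an edge between any two disjoint
    sets of size s.  A given pair is missed by each E(u) with probability at most
    exp(- d0 e(u, W) / (10 L)), hence by all of them with probability at most
    exp(- d0 n / (20 L)) by (P6), which beats the 'C(n, s)^2 = exp(o(n)) pairs. *)

(** * Degrees, neighbourhoods and edge counts in finite graphs *)

Section Graphs.
Local Open Scope nat_scope.
Variable T : finType.
Implicit Types (E F G : {set {set T}}) (U W S : {set T}) (u v w : T).

Lemma adj_sym E u v : adj E u v = adj E v u.
Proof. by rewrite /adj setUC. Qed.

Lemma adj_neq E u v : simple_graph E -> adj E u v -> u != v.
Proof.
move=> /forall_inP sE /sE; apply: contraTneq => ->.
by rewrite setUid cards1.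
Qed.

Lemma adj_sub F G u v : F \subset G -> adj F u v -> adj G u v.
Proof. by move=> /subsetP; apply. Qed.

Lemma edge_split G e v : simple_graph G -> e \in G -> v \in e ->
  exists2 w, w != v & e = [set v; w].
Proof.
move=> /forall_inP sG eG ve; have /cards2P[x [y [xy ee]]] := sG _ eG.
have : v \in [set x; y] by rewrite -ee.
rewrite !inE ee => /orP[] /eqP ->; first by exists y; rewrite // eq_sym.
by exists x => //; rewrite setUC.
Qed.

Lemma nbhdP E U w :
  reflect (w \notin U /\ exists2 u, u \in U & adj E u w) (w \in nbhd E U).
Proof.
rewrite /nbhd !inE; apply: (iffP andP) => -[-> H]; split => //.
  by have /existsP[u /andP[uU a]] := H; exists u.
by have [u uU a] := H; apply/existsP; exists u; rewrite uU.
Qed.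

Lemma degree_le_card_adj G v :
  simple_graph G -> degree G v <= #|[set w | adj G v w]|.
Proof.
move=> sG; apply: leq_trans (leq_imset_card (fun w => [set v; w]) _).
apply/subset_leq_card/subsetP => e; rewrite inE => /andP[eG ve].
have [w wv ee] := edge_split sG eG ve.
by apply/imsetP; exists w; rewrite // inE /adj -ee.
Qed.

Lemma sum_degree_in E U :
  \sum_(v in U) degree E v = \sum_(e in E) #|e :&: U|.
Proof.
under eq_bigr => v _ do rewrite /degree -sum1_card.
under [RHS]eq_bigr => e _ do rewrite -sum1_card.
rewrite (exchange_big_dep (mem E)) /=; last first.
  by move=> v e _; rewrite inE => /andP[].
apply: eq_bigr => e eE; apply: eq_bigl => v.
by rewrite !inE eE andTb andbC.
Qed.

(** In the degree sum over [U], an edge inside [U] counts twice and any other edge once. Edges are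
    counted in [G], where (P4) and (P5) bound them, while the neighbourhood is that of the subgraph
    [F]. *)
Lemma degree_count F G U d : simple_graph G -> F \subset G ->
  (forall v, v \in U -> d <= degree F v) ->
  d * #|U| <= 2 * #|edges_in G U| + #|edges_between G U (nbhd F U)|.
Proof.
move=> sG FG dF.
have -> : d * #|U| = \sum_(v in U) d by rewrite sum_nat_const mulnC.
apply: (@leq_trans (\sum_(v in U) degree F v)); first exact: leq_sum.
rewrite sum_degree_in.
rewrite (bigID (fun e : {set T} => e \subset U)) /=; apply: leq_add.
  apply: (@leq_trans (\sum_(e in edges_in G U) 2)); last first.
    by rewrite sum_nat_const mulnC.
  rewrite [leqLHS]big_mkcond [leqRHS]big_mkcond; apply: leq_sum => e _.
  rewrite !inE; case: ifP => // /andP[/(subsetP FG) eG eU]; rewrite eG eU /=.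
  have /forall_inP/(_ _ eG)/eqP <- := sG.
  by apply/subset_leq_card/subsetIl.
rewrite -sum1_card [leqLHS]big_mkcond [leqRHS]big_mkcond; apply: leq_sum => e _.
(* An edge of [F] that meets [U] without lying inside it has exactly one end in [U], and its other
   end lies in [nbhd F U]. *)
case: ifP => // /andP[eF eU]; have eG := subsetP FG _ eF.
have [->|[u]] := set_0Vmem (e :&: U); first by rewrite cards0.
rewrite inE => /andP[ue uU]; have [w wu ee] := edge_split sG eG ue.
have wU : w \notin U.
  apply: contra eU => wU; rewrite ee; apply/subsetP => z.
  by rewrite !inE => /orP[]/eqP->.
have -> : e \in edges_between G U (nbhd F U).
  rewrite inE eG /=; apply/existsP; exists u; rewrite uU /=.
  apply/existsP; exists w; rewrite ee eqxx andbT; apply/nbhdP; split => //.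
  by exists u; rewrite // /adj -ee.
rewrite -(cards1 u); apply/subset_leq_card/subsetP => z.
rewrite ee !inE => /andP[/orP[//|/eqP->]]; by rewrite (negbTE wU).
Qed.

Lemma card_bigcup_sum (I : finType) (A : {set I}) (B : I -> {set T}) :
  #|\bigcup_(i in A) B i| <= \sum_(i in A) #|B i|.
Proof.
elim/big_rec2: _ => [|i m C _ IH]; first by rewrite cards0.
by apply: leq_trans (leq_card_setU _ _) _; rewrite leq_add2l.
Qed.

Lemma card_bigcup_le (I : finType) (A : {set I}) (B : I -> {set T}) k :
  (forall i, i \in A -> #|B i| <= k) -> #|\bigcup_(i in A) B i| <= k * #|A|.
Proof.
move=> Bk; apply: leq_trans (card_bigcup_sum _ _) _.
by rewrite mulnC -sum_nat_const; apply: leq_sum.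
Qed.

(** * Expansion when no short path joins vertices of [S] *)

Section ShortPaths.
Variables (G : {set {set T}}) (S : {set T}).
Hypothesis sG : simple_graph G.
Hypothesis noshort : forall x p, graph_path G x p -> 1 <= size p <= 4 ->
  x \in S -> last x p \in S -> False.

Lemma small_not_adj u v : u \in S -> v \in S -> adj G u v -> False.
Proof.
move=> uS vS uv; apply: (noshort (x := u) (p := [:: v])) => //.
by rewrite /graph_path /= uv /= inE (adj_neq sG uv).
Qed.

(** Otherwise [u], [w], [v] would be a path of length 2 between vertices of [S]. *)
Lemma small_common_nbr u v w :
  u \in S -> v \in S -> adj G u w -> adj G v w -> u = v.
Proof.
move=> uS vS uw vw; apply/eqP; apply: contraT => uv; exfalso.
apply: (noshort (x := u) (p := [:: w; v])) => //.
rewrite /graph_path /= uw adj_sym vw /= !inE negb_or (adj_neq sG uw) uv.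
by rewrite eq_sym (adj_neq sG vw).
Qed.

(* Two distinct vertices of the closed neighbourhood of [u] adjacent to [S]
   would close up to a path (or a cycle) of length 3 or 4 through [u]. *)
Lemma small_second_nbr u w w' v v' :
  u \notin S -> v \in S -> v' \in S -> adj G v w -> adj G v' w' ->
  (w == u) || adj G u w -> (w' == u) || adj G u w' -> w = w'.
Proof.
move=> uS vS v'S vw v'w' uw uw'; apply/eqP; apply: contraT => ww'; exfalso.
have nS x y : x \in S -> adj G x y -> y \notin S.
  by move=> xS xy; apply/negP => yS; apply: small_not_adj xy.
have neS x y : x \in S -> y \notin S -> x != y.
  by move=> xS; apply: contraNneq => <-.
have wS := nS _ _ vS vw; have w'S := nS _ _ v'S v'w'.
(* As [w] and [w'] differ, at most one of them is [u]; by symmetry it is [w']. *)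
wlog wu : w w' v v' vS v'S vw v'w' uw uw' ww' wS w'S / w != u.
  move=> H; have [wu|wu] := boolP (w != u); first exact: (H w w' v v').
  apply: (H w' w v' v) => //; first by rewrite eq_sym.
  by move: wu; rewrite negbK => /eqP <-; rewrite eq_sym.
rewrite (negbTE wu) /= in uw.
have [eu|w'u] := eqVneq w' u.
  move: v'w'; rewrite eu => v'u.
  apply: (noshort (x := v) (p := [:: w; u; v'])) => //.
  rewrite /graph_path /= vw (adj_sym _ w) uw (adj_sym _ u) v'u /= !inE !negb_or.
  rewrite wu (eq_sym w v') (eq_sym u v') !(neS v' w, neS v' u) //.
  rewrite !(neS v w, neS v u) //=.
  (* If [v = v'], the closed walk falls under the cycle clause of [graph_path]. *)
  by rewrite (eq_sym v' v); case: (v == v').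
rewrite (negbTE w'u) /= in uw'.
apply: (noshort (x := v) (p := [:: w; u; w'; v'])) => //.
rewrite /graph_path /= vw (adj_sym _ w) uw uw' (adj_sym _ w') v'w' /=.
rewrite !inE !negb_or wu ww' (eq_sym w v') (eq_sym u v') (eq_sym w' v').
rewrite (eq_sym u w') w'u !(neS v' w, neS v' u, neS v' w') //.
rewrite !(neS v w, neS v u, neS v w') //=.
by rewrite (eq_sym v' v); case: (v == v').
Qed.

(** Double counting of adjacent pairs: each [v] in [U] has at least two neighbours, all outside [U]
    since [S] spans no edge, and no [w] is reached from two vertices of [U]. *)
Lemma small_set_nbhd F U : F \subset G -> U \subset S ->
  (forall v, v \in S -> incident G v \subset F) ->
  (forall v, v \in U -> 2 <= degree G v) ->
  2 * #|U| <= #|nbhd F U|.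
Proof.
move=> FG US GF d2.
have aGF v w : v \in S -> adj G v w -> adj F v w.
  move=> vS vw; apply: (subsetP (GF v vS)).
  by rewrite inE [_ \in G]vw !inE eqxx.
have -> : 2 * #|U| = \sum_(v in U) 2 by rewrite sum_nat_const mulnC.
apply: (@leq_trans (\sum_(v in U) degree G v)); first exact: leq_sum.
apply: (@leq_trans (\sum_(v in U) \sum_(w in nbhd F U | adj G v w) 1)).
  apply: leq_sum => v vU; apply: leq_trans (degree_le_card_adj v sG) _.
  rewrite sum1_card; apply/subset_leq_card/subsetP => w; rewrite inE => vw.
  rewrite unfold_in /= vw andbT; apply/nbhdP; split.
    apply/negP => wU; apply: small_not_adj vw; exact: (subsetP US).
  by exists v => //; apply: aGF => //; apply: (subsetP US).
rewrite (exchange_big_dep (mem (nbhd F U))) /=; last by move=> v w _ /andP[].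
rewrite -sum1_card; apply: leq_sum => w wN.
rewrite sum1_card; apply/card_le1_eqP => v v'; rewrite !inE.
move=> /andP[vU /andP[_ vw]] /andP[v'U /andP[_ v'w]].
by apply: small_common_nbr v'w vw; apply: (subsetP US).
Qed.

Lemma nbhd_expands F U : F \subset G ->
  (forall v, v \in S -> incident G v \subset F) ->
  (forall v, 2 <= degree G v) ->
  4 * #|U :\: S| <= #|nbhd F (U :\: S)| ->
  2 * #|U| <= #|nbhd F U|.
Proof.
move=> FG GF d2 big; set U1 := U :&: S; set U2 := U :\: S in big *.
have N1 : 2 * #|U1| <= #|nbhd F U1|.
  by apply: small_set_nbhd => //; apply: subsetIr.
have aG v w : adj F v w -> adj G v w by apply: adj_sub.
set N1' := nbhd F U1 in N1 *; set N2' := nbhd F U2 in big *.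
(* [U2 :|: N2'] is covered by the closed [G]-neighbourhoods of the vertices of [U2], and each of
   these contains at most one point adjacent to [S]. *)
have I1 : #|N1' :&: (U2 :|: N2')| <= 1 * #|U2|.
  apply: leq_trans (@card_bigcup_le _ U2
    (fun u => [set w in N1' | (w == u) || adj G u w]) 1 _).
    apply/subset_leq_card/subsetP => w; rewrite inE => /andP[wN].
    rewrite inE => /orP[wU|/nbhdP[_ [u uU uw]]]; apply/bigcupP.
      by exists w => //; rewrite inE wN eqxx.
    by exists u => //; rewrite inE wN (aG _ _ uw) orbT.
  move=> u; rewrite inE => /andP[uS _]; apply/card_le1_eqP => w w'.
  rewrite [w \in _]inE [w' \in _]inE => /andP[/nbhdP[_ [v]]].
  rewrite inE => /andP[_ vS] /aG vw uw.
  move=> /andP[/nbhdP[_ [v']]]; rewrite inE => /andP[_ v'S] /aG v'w' uw'.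
  exact: small_second_nbr v'w' vw uw' uw.
have I2 : #|N2' :&: U1| <= 1 * #|U2|.
  apply: leq_trans (@card_bigcup_le _ U2 (fun u => [set w in S | adj G u w]) 1 _).
    apply/subset_leq_card/subsetP => w; rewrite inE => /andP[/nbhdP[_ [u uU uw]]].
    rewrite inE => /andP[_ wS]; apply/bigcupP; exists u => //.
    by rewrite inE wS aG.
  move=> u _; apply/card_le1_eqP => w w'.
  rewrite !inE => /andP[wS uw] /andP[w'S uw'].
  by apply: (@small_common_nbr _ _ u) => //; rewrite adj_sym.
(* Two disjoint pieces of [nbhd F U], of sizes at least [2|U1| - |U2|] and [4|U2| - |U2|], which add
   up to [2|U|]. *)
have D : #|N1' :\: (U2 :|: N2')| + #|N2' :\: U1| <= #|nbhd F U|.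
  have I0 : (N1' :\: (U2 :|: N2')) :&: (N2' :\: U1) = set0.
    apply/setP => w; rewrite in_setI !in_setD in_setU in_set0.
    by case: (w \in N2'); rewrite ?orbT ?andbF.
  rewrite -cardsUI I0.
  rewrite cards0 addn0; apply/subset_leq_card/subsetP => w.
  rewrite in_setU !in_setD; case/orP => /andP[].
    rewrite in_setU negb_or => /andP[wU2 _] /nbhdP[wU1 [u]].
    rewrite inE => /andP[uU _] uw; apply/nbhdP; split; last by exists u.
    by move: wU1 wU2; rewrite !inE; case: (w \in U); case: (w \in S).
  move=> wU1 /nbhdP[wU2 [u]]; rewrite inE => /andP[_ uU] uw.
  apply/nbhdP; split; last by exists u.
  by move: wU1 wU2; rewrite !inE; case: (w \in U); case: (w \in S).
rewrite -(cardsID S U) -/U1 -/U2.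
have := cardsID (U2 :|: N2') N1'; have := cardsID U1 N2'.
move: N1 big I1 I2 D.
move: #|U1| #|U2| #|N1'| #|N2'| #|nbhd F U| => a b c d e.
move: #|N1' :&: _| #|N1' :\: _| #|N2' :&: _| #|N2' :\: _| => f g h i.
lia.
Qed.

End ShortPaths.

(** * Expansion of large sets *)

Lemma exists_subset_card U k :
  k <= #|U| -> exists2 A : {set T}, A \subset U & #|A| = k.
Proof.
move=> kU; have : 0 < #|[set A : {set T} | A \subset U & #|A| == k]|.
  by rewrite cards_draws bin_gt0.
by case/card_gt0P => A; rewrite inE => /andP[AU /eqP Ak]; exists A.
Qed.

(** No edge of [F] joins [U] to the complement of [U :|: nbhd F U], so this complement has fewer
    than [s] points. Hence [|N(U)| > |T| - |U| - s >= |T| / 2 >= 2|U|]. *)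
Lemma nbhd_large F U s :
  (forall U' W', [disjoint U' & W'] -> #|U'| = s -> #|W'| = s ->
     exists u w, [/\ u \in U', w \in W' & adj F u w]) ->
  4 * s <= #|T| -> s <= #|U| -> 4 * #|U| <= #|T| -> 2 * #|U| <= #|nbhd F U|.
Proof.
move=> H sT sU UT; have [U' U'U cU'] := exists_subset_card sU.
have Wlt : #|~: (U :|: nbhd F U)| < s.
  rewrite ltnNge; apply/negP => /exists_subset_card[W' /subsetP W'W cW'].
  have [] // := H U' W'.
    rewrite disjoints_subset; apply/subsetP => x /(subsetP U'U) xU.
    by rewrite inE; apply/negP => /W'W; rewrite !inE xU.
  move=> u [w [/(subsetP U'U) uU /W'W]].
  rewrite inE inE negb_or => /andP[wU /negP wN] uw.
  by apply: wN; apply/nbhdP; split => //; exists u.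
have := cardsC (U :|: nbhd F U); have [+ _] := leq_card_setU U (nbhd F U).
move: Wlt sT sU UT.
move: #|T| #|U| #|nbhd F U| #|_ :|: _| #|~: _| => t a b c e.
lia.
Qed.

End Graphs.

(** * Binomial estimates and the law of the random choices *)

Section Probability.
Variable R : realType.

(** The inequality [(m - i) / (D - i) <= m / D], multiplied over [i < d] and cleared of
    denominators. *)
Lemma ffact_ratio (m D d : nat) :
  (m <= D)%N -> (m ^_ d * D ^ d <= D ^_ d * m ^ d)%N.
Proof.
move=> mD; elim: d => [//|d IH].
rewrite !ffactnSr !expnSr mulnACA [leqRHS]mulnACA.
apply: leq_mul IH _; rewrite !mulnBl leq_sub // ?leq_mul2l ?mD ?orbT //.
by rewrite mulnC.
Qed.

(** The left side is the probability that a uniform [d]-subset of a [D]-set avoids a fixed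
    [k]-subset; it is at most [(1 - k/D)^d]. *)
Lemma bin_ratio_le_expR (D k d : nat) : (0 < D)%N -> (k <= D)%N -> (d <= D)%N ->
  'C(D - k, d)%:R / 'C(D, d)%:R <= expR (- (d%:R * k%:R / D%:R)) :> R.
Proof.
move=> D0 kD dD.
have D0R : 0 < D%:R :> R by rewrite ltr0n.
have C0 : 0 < 'C(D, d)%:R :> R by rewrite ltr0n bin_gt0.
have base : ((D - k)%:R / D%:R) <= expR (- (k%:R / D%:R)) :> R.
  apply: le_trans (expR_ge1Dx _); rewrite natrB // mulrBl divff ?gt_eqF //.
have -> : - (d%:R * k%:R / D%:R) = d%:R * - (k%:R / D%:R) :> R.
  by rewrite mulrN mulrA.
rewrite expRM_natl.
apply: (@le_trans _ _ (((D - k)%:R / D%:R) ^+ d)); last first.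
  by apply: lerXn2r; rewrite // nnegrE ?expR_ge0 // divr_ge0.
rewrite expr_div_n ler_pdivrMr // mulrAC ler_pdivlMr ?exprn_gt0 //.
rewrite -!natrX -!natrM ler_nat [leqRHS]mulnC -(leq_pmul2r (fact_gt0 d)).
rewrite mulnAC bin_ffact [leqRHS]mulnAC bin_ffact.
by apply: ffact_ratio; exact: leq_subr.
Qed.

Section Choices.
Variables (T : finType) (G : {set {set T}}) (d : nat).

Lemma sum_uniform (S : finType) (C : {set S}) (Q : pred S) :
  \sum_(A | Q A) uniform R C A = #|[set A in C | Q A]|%:R / #|C|%:R.
Proof.
rewrite -sum1_card natr_sum big_distrl /=.
rewrite [LHS]big_mkcond [RHS]big_mkcond; apply: eq_bigr => A _.
by rewrite inE /uniform mul1r; case: (A \in C); case: (Q A).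
Qed.

Lemma choice_law_ge0 X : 0 <= choice_law R G d X.
Proof.
by apply: prodr_ge0 => v _; rewrite /uniform; case: ifP; rewrite ?invr_ge0.
Qed.

Lemma choice_law_neq0 X v : choice_law R G d X != 0 -> X v \in choices G d v.
Proof.
move=> /prodf_neq0/(_ v isT); rewrite /uniform; case: ifP => //.
by rewrite eqxx.
Qed.

(** Independence: the probability of a conjunction of one condition per vertex factors, by
    distributing the product over the sums. *)
Lemma choice_prob_forall (Q : T -> pred {set {set T}}) :
  choice_prob R G d (fun X => [forall v, Q v (X v)]) =
  \prod_v \sum_(A | Q v A) uniform R (choices G d v) A.
Proof.
rewrite bigA_distr_big_dep; apply: eq_bigl => X.
by apply/forallP/familyP => H v; apply: H.
Qed.

Lemma card_choices_gt0 v : (0 < #|choices G d v|)%N.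
Proof.
rewrite /choices; case: ifP => [_|]; first by rewrite cards1.
rewrite inE => /negbT; rewrite -leqNgt => dv.
under eq_finset do rewrite powersetE.
by rewrite cards_draws bin_gt0.
Qed.

Lemma choice_prob_total : choice_prob R G d predT = 1.
Proof.
have -> : choice_prob R G d predT
    = choice_prob R G d (fun X => [forall v, predT (X v)]).
  by apply: eq_bigl => X; apply/esym/forallP.
rewrite (choice_prob_forall (fun=> predT)); apply: big1 => v _.
rewrite sum_uniform (_ : [set A in _ | _] = choices G d v).
  by rewrite divff // pnatr_eq0 -lt0n card_choices_gt0.
by apply/setP => A; rewrite inE andbT.
Qed.

(** A vertex of small degree keeps all its edges, so it misses [B] only if [B] is empty, when the
    bound is 1. Otherwise the binomial ratio applies, and enlarging the degree to [D] weakens the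
    bound. *)
Lemma uniform_miss (v : T) (B : {set {set T}}) (D : R) :
  B \subset incident G v -> (0 < degree G v)%N -> (degree G v)%:R <= D ->
  \sum_(A : {set {set T}} | [disjoint A & B]) uniform R (choices G d v) A
    <= expR (- (d%:R * #|B|%:R / D)).
Proof.
move=> BG deg0 degD.
have D0 : 0 < D by apply: lt_le_trans degD; rewrite ltr0n.
rewrite sum_uniform /choices; case: ifP => [_|].
  rewrite cards1 divr1.
  have [->|[e eB]] := set_0Vmem B.
    rewrite cards0 mulr0 mul0r oppr0 expR0 lern1.
    apply: (@leq_trans #|[set incident G v]|); last by rewrite cards1.
    by apply/subset_leq_card/subsetP => A; rewrite inE => /andP[].
  rewrite (_ : [set _ in _ | _] = set0) ?cards0 ?expR_ge0 //.
  apply/setP => A; rewrite !inE; apply/negP => /andP[/eqP ->].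
  by move/disjointFl/(_ eB); rewrite (subsetP BG).
rewrite inE => /negbT; rewrite -leqNgt => dv.
rewrite [X in X%:R / _](_ : _ = 'C(degree G v - #|B|, d)); last first.
  have -> : (degree G v - #|B|)%N = #|incident G v :\: B|.
    by rewrite cardsD (setIidPr BG).
  rewrite -cards_draws; apply: eq_card => A.
  by rewrite !inE subsetD andbAC.
rewrite [X in _ / X%:R](_ : _ = 'C(degree G v, d)); last first.
  by rewrite -cards_draws; apply: eq_card => A; rewrite !inE.
apply: le_trans (bin_ratio_le_expR _ _ _) _ => //; first exact: subset_leq_card.
rewrite ler_expR lerN2 ler_wpM2l ?mulr_ge0 //.
by rewrite lef_pV2 // posrE ltr0n.
Qed.

(** Only the choices made at vertices of [U] are tested, so the event is a conjunction of
    independent ones; its failure still yields an edge of [Gamma0 X] from [U] to [W]. *)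
Definition misses (X : {ffun T -> {set {set T}}}) (U W : {set T}) : bool :=
  [forall v, (v \in U) ==> [disjoint X v & edges_between G [set v] W]].

Lemma card_edges_between_le (U W : {set T}) :
  (#|edges_between G U W| <= \sum_(v in U) #|edges_between G [set v] W|)%N.
Proof.
apply: leq_trans (card_bigcup_sum _ _).
apply/subset_leq_card/subsetP => e; rewrite inE => /andP[eG /existsP[u]].
move=> /andP[uU /existsP[w /andP[wW ew]]]; apply/bigcupP; exists u => //.
rewrite inE eG; apply/existsP; exists u; rewrite set11 /=.
by apply/existsP; exists w; rewrite wW.
Qed.

(** Vertices outside [U] contribute factors at most 1. Over [U] the exponents add up, and the edge
    counts of the single vertices sum to at least [#|edges_between G U W|]. *)
Lemma prob_misses (U W : {set T}) (D : R) :
  0 < D -> (forall v, 0 < degree G v)%N -> (forall v, (degree G v)%:R <= D) ->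
  choice_prob R G d (fun X => misses X U W)
    <= expR (- (d%:R * #|edges_between G U W|%:R / D)).
Proof.
move=> D0 deg0 degD.
rewrite (choice_prob_forall
  (fun v A => (v \in U) ==> [disjoint A & edges_between G [set v] W])).
apply: (@le_trans _ _ (\prod_(v in U)
    expR (- (d%:R * #|edges_between G [set v] W|%:R / D)))).
  rewrite [leRHS]big_mkcond; apply: ler_prod => v _; apply/andP; split.
    by apply: sumr_ge0 => A _; rewrite /uniform; case: ifP; rewrite ?invr_ge0.
  case: (v \in U) => /=; last first.
    by rewrite sum_uniform ler_pdivrMr ?ltr0n ?card_choices_gt0 // mul1r ler_nat
      subset_leq_card //; apply/subsetP => A; rewrite inE => /andP[].
  apply: uniform_miss => //; apply/subsetP => e; rewrite !inE.
  move=> /andP[-> /existsP[u]]; rewrite inE => /andP[/eqP-> /existsP[w]].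
  by move=> /andP[_ /eqP->]; rewrite !inE eqxx.
rewrite -expR_sum ler_expR sumrN lerN2 -mulr_suml -mulr_sumr -natr_sum.
rewrite ler_pM2r ?invr_gt0 //; apply: ler_wpM2l => //.
by rewrite ler_nat card_edges_between_le.
Qed.

(** Union bound. The implication to [good] is asked only of admissible families, since all others
    have law 0. *)
Lemma prob_union (I : finType) (K : {set I})
    (good : pred {ffun T -> {set {set T}}})
    (bad : I -> pred {ffun T -> {set {set T}}}) (b : R) :
  (forall X : {ffun T -> {set {set T}}}, (forall v, X v \in choices G d v) ->
     (forall i, i \in K -> ~~ bad i X) -> good X) ->
  (forall i, i \in K -> choice_prob R G d (bad i) <= b) ->
  1 - #|K|%:R * b <= choice_prob R G d good.
Proof.
move=> Hgood Hbad; rewrite -[X in X - _]choice_prob_total.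
have -> : choice_prob R G d predT =
    choice_prob R G d good + choice_prob R G d (predC good).
  by rewrite /choice_prob (bigID good).
rewrite lerBlDr lerD2l.
apply: (@le_trans _ _ (\sum_(i in K) choice_prob R G d (bad i))); last first.
  apply: (@le_trans _ _ (\sum_(i in K) b)); first exact: ler_sum.
  by rewrite sumr_const mulr_natl.
rewrite [leRHS](exchange_big_dep predT) //= /choice_prob [leLHS]big_mkcond.
apply: ler_sum => X _; case: ifP => [nG|_]; last first.
  by apply: sumr_ge0 => *; apply: choice_law_ge0.
have [->|l0] := eqVneq (choice_law R G d X) 0.
  by rewrite sumr_ge0.
have /existsP[i /andP[iK biX]] : [exists i, (i \in K) && bad i X].
  apply: contraT => /existsPn H; move: nG => /negP[]; apply: Hgood.
    by move=> v; apply: choice_law_neq0.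
  by move=> i iK; have := H i; rewrite iK.
rewrite (bigD1 i) /= ?iK // lerDl sumr_ge0 // => *.
exact: choice_law_ge0.
Qed.

End Choices.

(** ['C(n, s) * x ^+ s] is one term of the expansion of [(1 + x) ^+ n], which is at most
    [expR (x * n)]. The parameter [x] stays free, to be tuned later. *)
Lemma bin_le_expR (n s : nat) (x : R) : 0 < x ->
  'C(n, s)%:R <= expR (x * n%:R + s%:R * - ln x).
Proof.
move=> x0.
have [sn|ns] := leqP s n; last by rewrite bin_small ?expR_ge0.
rewrite mulrN expRB expRM_natr expRM_natl lnK ?posrE //.
rewrite ler_pdivlMr ?exprn_gt0 //.
apply: (@le_trans _ _ ((1 + x) ^+ n)); last first.
  by apply: lerXn2r; rewrite ?nnegrE ?expR_ge0 ?expR_ge1Dx // addr_ge0 // ltW.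
rewrite exprDn (bigD1 (inord s)) //= inordK ?ltnS //.
rewrite expr1n mul1r mulr_natl lerDl sumr_ge0 // => i _.
by rewrite mulrn_wge0 // mulr_ge0 ?exprn_ge0 ?ltW // expr1n.
Qed.

End Probability.

(** * Properties of [Gamma0] valid for every admissible choice *)

Section Support.
Local Open Scope nat_scope.
Variables (T : finType) (G : {set {set T}}) (d : nat).
Variable X : {ffun T -> {set {set T}}}.
Hypothesis supp : forall v, X v \in choices G d v.

Lemma choice_sub_incident v : X v \subset incident G v.
Proof.
have := supp v; rewrite /choices; case: ifP => _; first by rewrite inE => /eqP->.
by rewrite !inE => /andP[].
Qed.

Lemma card_choice_le v : #|X v| <= d.
Proof.
have := supp v; rewrite /choices; case: ifP => [sv|_].
  by rewrite inE => /eqP->; move: sv; rewrite inE => /ltnW.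
by rewrite !inE => /andP[_ /eqP->].
Qed.

Lemma choice_sub_Gamma0 v : X v \subset Gamma0 X.
Proof. exact: bigcup_sup. Qed.

Lemma Gamma0_sub : Gamma0 X \subset G.
Proof.
apply/bigcupsP => v _; apply: subset_trans (choice_sub_incident v) _.
by apply/subsetP => e; rewrite inE => /andP[].
Qed.

Lemma incident_small_sub v : v \in small G d -> incident G v \subset Gamma0 X.
Proof.
move=> sv; apply: subset_trans (choice_sub_Gamma0 v).
by have := supp v; rewrite /choices sv inE => /eqP->.
Qed.

Lemma degree_Gamma0_ge v : v \notin small G d -> d <= degree (Gamma0 X) v.
Proof.
move=> sv; have := supp v; rewrite /choices (negbTE sv) !inE => /andP[_ /eqP dX].
rewrite -[leqLHS]dX; apply/subset_leq_card/subsetP => e eX.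
rewrite inE (subsetP (choice_sub_Gamma0 v)) //=.
by have := subsetP (choice_sub_incident v) _ eX; rewrite inE => /andP[].
Qed.

Lemma card_Gamma0_le : #|Gamma0 X| <= d * #|T|.
Proof.
rewrite -cardsT; apply: leq_trans (@card_bigcup_le _ _ setT X d _).
  by rewrite /Gamma0; under eq_bigl => v do rewrite -(in_setT v).
by move=> v _; apply: card_choice_le.
Qed.

Lemma not_misses_adj (U W : {set T}) : ~~ misses G X U W ->
  exists u w, [/\ u \in U, w \in W & adj (Gamma0 X) u w].
Proof.
rewrite negb_forall => /existsP[u]; rewrite negb_imply => /andP[uU].
rewrite disjoint_subset => /subsetPn[e eX]; rewrite inE negbK inE.
move=> /andP[_ /existsP[u']]; rewrite inE => /andP[/eqP->].
move=> /existsP[w /andP[wW /eqP ee]].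
by exists u, w; split => //; rewrite /adj -ee (subsetP (choice_sub_Gamma0 u)).
Qed.

End Support.

(** * Powers of the logarithm and deterministic expansion *)

Section Threshold.
Variables (R : realType) (n : nat).
(** The exponents in (P4), (P5) and (P6) are multiples of 1/4, so the real powers of [ln n] become
    integer powers of [q]. *)
Let q : R := lnpow n (1 / 4 : R).

Lemma lnpow_quarter (k : nat) : lnpow n (k%:R / 4 : R) = q ^+ k.
Proof.
by rewrite /q /lnpow -powR_mulrn ?powR_ge0 // -powRrM div1r mulrC.
Qed.

Lemma lnpow_half : lnpow n (1 / 2 : R) = q ^+ 2.
Proof. by rewrite -lnpow_quarter; congr lnpow; field. Qed.

Lemma lnpow_three_quarters : lnpow n (3 / 4 : R) = q ^+ 3.
Proof. exact: (lnpow_quarter 3). Qed.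

Lemma ln_eq_quarter : 0 <= ln n%:R :> R -> ln n%:R = q ^+ 4.
Proof.
by move=> L0; rewrite -(lnpow_quarter 4) /lnpow divff ?powRr1 ?pnatr_eq0.
Qed.

Variables (delta0 : R) (G : {set {set 'I_n}}).
Variable (X : {ffun 'I_n -> {set {set 'I_n}}}).
Hypothesis sG : simple_graph G.
Hypothesis supp : forall v, X v \in choices G (d0 delta0 n) v.
Hypothesis p4 : P4 R G.
Hypothesis p5 : P5 delta0 G.
Hypothesis q4 : 4 <= q.
Hypothesis dq : 4 * q ^+ 3 < (d0 delta0 n)%:R.

Lemma nbhd_nonsmall (U : {set 'I_n}) : [disjoint U & small G (d0 delta0 n)] ->
  #|U|%:R <= n%:R / q ^+ 2 -> (4 * #|U| <= #|nbhd (Gamma0 X) U|)%N.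
Proof.
move=> dU Ule; have [->|[u0 u0U]] := set_0Vmem U; first by rewrite cards0.
have U0 : 0 < #|U|%:R :> R by rewrite ltr0n; apply/card_gt0P; exists u0.
rewrite -(ler_nat R) natrM.
(* If [|N(U)| > q|U|], then [q >= 4] suffices. Otherwise (P5) applies to [U] and [N(U)], and with
   (P4) the degree count gives [d0|U| <= 2q^3|U| + d0|U|/2], contradicting [4q^3 < d0]. *)
have [Nle|/ltW] := leP #|nbhd (Gamma0 X) U|%:R (#|U|%:R * q); last first.
  by apply: le_trans; rewrite mulrC ler_wpM2l // ltW.
have := p4; rewrite /P4 lnpow_half lnpow_three_quarters => /(_ U Ule) e4.
have := p5; rewrite /P5 lnpow_half => /(_ U (nbhd (Gamma0 X) U)) e5.
have dUN : [disjoint U & nbhd (Gamma0 X) U].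
  rewrite disjoint_subset; apply/subsetP => x xU; rewrite inE.
  by apply/negP => /nbhdP[]; rewrite xU.
have {}e5 := e5 dUN Ule Nle.
have cnt : (d0 delta0 n * #|U|
    <= 2 * #|edges_in G U| + #|edges_between G U (nbhd (Gamma0 X) U)|)%N.
  apply: degree_count => //; first exact: Gamma0_sub supp.
  by move=> v vU; apply: degree_Gamma0_ge => //; rewrite (disjointFr dU).
move: cnt; rewrite -(ler_nat R) natrD !natrM => cnt.
have : 4 * q ^+ 3 * #|U|%:R < (d0 delta0 n)%:R * #|U|%:R by rewrite ltr_pM2r.
by lra.
Qed.

Lemma expander_Gamma0 (s : nat) :
  (forall v, 2 <= degree G v)%N -> P3 delta0 G ->
  s%:Z = Num.ceil (n%:R / q ^+ 2) -> (4 * s <= n)%N ->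
  (forall U W : {set 'I_n}, [disjoint U & W] -> #|U| = s -> #|W| = s ->
     ~~ misses G X U W) ->
  expander (Gamma0 X) (n%:R / 4 : R) 2.
Proof.
move=> d2 p3 sE sn nm; apply/forallP => U; apply/implyP => Un.
rewrite -natrM ler_nat.
have [Ule|Ugt] := leP (#|U|%:R) (n%:R / q ^+ 2).
  apply: (@nbhd_expands _ G (small G (d0 delta0 n))) => //.
  - by move=> x p gp sp xS lS; apply: p3; exists x, p.
  - exact: Gamma0_sub supp.
  - by move=> v; apply: incident_small_sub.
  apply: nbhd_nonsmall.
    rewrite disjoint_subset; apply/subsetP => x; rewrite inE.
    by move=> /andP[].
  by apply: le_trans Ule; rewrite ler_nat subset_leq_card ?subsetDl.
apply: (@nbhd_large _ _ _ s); rewrite ?card_ord //.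
- by move=> U' W' dUW cU cW; apply: not_misses_adj (nm _ _ dUW cU cW).
- by rewrite -lez_nat sE ceil_le_int ltW.
- by move: Un; rewrite ler_pdivlMr // -natrM ler_nat mulnC.
Qed.

End Threshold.

(** * Union bound over pairs of sets, and asymptotics *)

(** There are at most ['C(n, s) ^+ 2] ordered pairs of disjoint [s]-sets. For each, [prob_misses] is
    applied with the degree bound [10 * ln n] of (P1) and the [n / 2] edges of (P6). *)
Lemma prob_expander_Gamma0 (R : realType) (delta0 : R) (n s : nat)
    (G : {set {set 'I_n}}) :
  simple_graph G -> P1 R G -> P3 delta0 G -> P4 R G -> P5 delta0 G -> P6 R G ->
  4 <= lnpow n (1 / 4 : R) ->
  4 * lnpow n (1 / 4 : R) ^+ 3 < (d0 delta0 n)%:R ->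
  s%:Z = Num.ceil (n%:R / lnpow n (1 / 4 : R) ^+ 2) -> (4 * s <= n)%N ->
  0 < ln n%:R :> R ->
  1 - 'C(n, s)%:R ^+ 2 * expR (- ((d0 delta0 n)%:R * (n%:R / 2) / (10 * ln n%:R)))
    <= choice_prob R G (d0 delta0 n)
          (fun X => expander (Gamma0 X) (n%:R / 4 : R) 2
                    && (#|Gamma0 X| <= d0 delta0 n * n)%N).
Proof.
move=> sG p1 p3 p4 p5 p6 q4 dq sE sn L0.
pose D : {set {set 'I_n}} := [set A : {set 'I_n} | #|A| == s].
pose K := [set p in setX D D | [disjoint p.1 & p.2]].
have cK : #|K|%:R <= 'C(n, s)%:R ^+ 2 :> R.
  rewrite -natrX ler_nat; apply: (@leq_trans #|setX D D|).
    by apply/subset_leq_card/subsetP => p; rewrite inE => /andP[].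
  by rewrite cardsX card_draws card_ord mulnn.
set b := expR _.
apply: (@le_trans _ _ (1 - #|K|%:R * b)).
  by rewrite lerD2l lerN2 ler_wpM2r ?expR_ge0.
apply: (@prob_union _ _ _ _ _ K _ (fun p X => misses G X p.1 p.2))
  => [X supp nm|p].
  apply/andP; split; last by have := card_Gamma0_le supp; rewrite card_ord.
  apply: (expander_Gamma0 sG supp p4 p5 q4 dq _ p3 sE sn) => [v|U W dUW cU cW].
    by have [] := p1 v.
  by apply: (nm (U, W)); rewrite !inE cU cW !eqxx.
rewrite !inE => /andP[/andP[/eqP c1 /eqP c2] dp].
apply: le_trans (@prob_misses R _ G _ p.1 p.2 (10 * ln n%:R) _ _ _) _.
- by rewrite mulr_gt0.
- by move=> v; have [_ /ltnW] := p1 v.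
- by move=> v; have [] := p1 v.
rewrite ler_expR lerN2 ler_pM2r ?invr_gt0 ?mulr_gt0 // ler_wpM2l //.
by apply: p6; rewrite // lnpow_half -sE ?c1 ?c2.
Qed.

Theorem lemma4p6 (R : realType) :
  exists2 c : R, 0 < c &
    forall delta0 : R, 0 < delta0 < c ->
    forall eps : R, 0 < eps ->
    exists N : nat, forall n : nat, (N <= n)%N ->
    forall G : {set {set 'I_n}}, simple_graph G ->
      P1 R G -> P2 delta0 G -> P3 delta0 G ->
      P4 R G -> P5 delta0 G -> P6 R G ->
      1 - eps <=
        choice_prob R G (d0 delta0 n)
          (fun X => expander (Gamma0 X) (n%:R / 4 : R) 2
                    && (#|Gamma0 X| <= d0 delta0 n * n)%N).
Proof.
exists 1 => // delta0 /andP[de0 _] eps eps0.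
(* With [d0 >= delta0 * ln n / 2], the exponent [d0 * n / (20 * ln n)] is at least
   [delta0 * n / 40 = 10 * x * n], whereas the number of pairs will be at most
   [expR (4 * x * n)]. *)
pose x := delta0 / 400.
have x0 : 0 < x by rewrite divr_gt0.
(* Once [q] and [n] exceed [M], the summands serve in turn for [4 <= q] and [4 * s <= n]; for
   [4 * q ^+ 3 < d0]; for [s * - ln x <= x * n]; and for [expR (- (x * n)) <= eps]. *)
pose M := 8 + 8 / delta0 + 2 * `|ln x| / x + (x * eps)^-1.
(* The term [expR (M ^+ 4)] gives [M ^+ 4 <= ln n = q ^+ 4], hence [M <= q]; the extra [M] gives
   [M < n]. *)
exists (Num.truncn (expR (M ^+ 4) + M)).+1 => n Nn G sG p1 p2 p3 p4 p5 p6.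
have h1 : 0 < 8 / delta0 by rewrite divr_gt0.
have h2 : 0 <= 2 * `|ln x| / x by apply: divr_ge0; [apply: mulr_ge0 | apply: ltW].
have h3 : 0 < (x * eps)^-1 by rewrite invr_gt0 mulr_gt0.
have M8 : 8 <= M by rewrite /M; lra.
have M0 : 0 < M by lra.
have nM : expR (M ^+ 4) + M < n%:R.
  by apply: lt_le_trans (truncnS_gt _) _; rewrite ler_nat.
have e0 := expR_gt0 (M ^+ 4).
have n0 : 0 < n%:R :> R by lra.
have L4 : M ^+ 4 <= ln n%:R :> R.
  by rewrite -ler_expR lnK ?posrE //; lra.
have L0 : 0 < ln n%:R :> R by apply: lt_le_trans L4; rewrite exprn_gt0.
set q : R := lnpow n (1 / 4).
have q0 : 0 <= q by apply: powR_ge0.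
have Lq : ln n%:R = q ^+ 4 :> R by apply/ln_eq_quarter/ltW.
have Mq : M <= q.
  by move: L4; rewrite Lq ler_pXn2r // nnegrE ltW.
have d8 : 8 <= delta0 * q.
  have : 8 / delta0 <= q by rewrite /M in Mq; lra.
  by rewrite ler_pdivrMr // mulrC.
have q1 : 1 <= q by lra.
have qn : 0 < q by lra.
have q3 : 1 <= q ^+ 3 by apply: exprn_ege1.
have dL : 8 * q ^+ 3 <= delta0 * ln n%:R.
  by rewrite Lq (exprS q 3) mulrA ler_wpM2r // exprn_ge0.
have d0gt : delta0 * ln n%:R - 1 < (d0 delta0 n)%:R.
  by have := truncnS_gt (delta0 * ln n%:R); rewrite -natr1 /d0; lra.
pose s := `|Num.ceil (n%:R / q ^+ 2)|%N.
have nq0 : 0 <= n%:R / q ^+ 2 by rewrite divr_ge0 ?exprn_ge0 // ltW.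
have sE : s%:Z = Num.ceil (n%:R / q ^+ 2).
  rewrite /s gez0_abs // ceil_ge0; lra.
have s1 : s%:R <= n%:R / q ^+ 2 + 1.
  have /andP[+ _] := ceil_itv (n%:R / q ^+ 2).
  by rewrite -sE intrB /= => H; apply/ltW; rewrite -ltrBlDr.
have nqM : n%:R / q ^+ 2 <= n%:R / M.
  rewrite ler_pM2l // lef_pV2 ?posrE ?exprn_gt0 //.
  by apply: le_trans Mq _; rewrite expr2 ler_peMr.
have nMr : M < n%:R by lra.
(* The 1 lost to the ceiling is absorbed by [1 <= n / M]. *)
have s2 : s%:R <= 2 * n%:R / M.
  have : 1 <= n%:R / M by rewrite ler_pdivlMr // mul1r ltW.
  by rewrite -mulrA; lra.
have sn : (4 * s <= n)%N.
  rewrite -(ler_nat R) natrM.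
  have : 2 * n%:R / M <= n%:R / 4.
    rewrite ler_pdivrMr //.
    have : n%:R * 8 <= n%:R * M by rewrite ler_pM2l.
    by lra.
  by lra.
have sx : s%:R * - ln x <= x * n%:R.
  apply: (@le_trans _ _ (s%:R * `|ln x|)).
    by rewrite ler_wpM2l // -normrN ler_norm.
  apply: (@le_trans _ _ (2 * n%:R / M * `|ln x|)); first by rewrite ler_wpM2r.
  rewrite mulrAC ler_pdivrMr //.
  have : 2 * `|ln x| <= M * x.
    rewrite -ler_pdivrMr // /M; lra.
  by move=> /(ler_wpM2l (ltW n0)); lra.
apply: le_trans (prob_expander_Gamma0 sG p1 p3 p4 p5 p6 _ _ sE sn L0);
  rewrite -/q; [|by lra|by lra].
rewrite lerD2l lerN2.
have C1 : 'C(n, s)%:R <= expR (2 * x * n%:R) :> R.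
  by apply: le_trans (bin_le_expR _ _ x0) _; rewrite ler_expR; lra.
have b1 : 10 * x * n%:R <= (d0 delta0 n)%:R * (n%:R / 2) / (10 * ln n%:R).
  rewrite ler_pdivlMr ?mulr_gt0 //.
  have : delta0 * ln n%:R / 2 <= (d0 delta0 n)%:R by lra.
  by move=> /(ler_wpM2r (ltW n0)); rewrite /x; lra.
apply: (@le_trans _ _ (expR (2 * x * n%:R) ^+ 2 * expR (- (10 * x * n%:R)))).
  apply: ler_pM; rewrite ?exprn_ge0 ?expR_ge0 //.
    by apply: lerXn2r; rewrite ?nnegrE ?expR_ge0.
  by rewrite ler_expR lerN2.
rewrite -expRM_natl -expRD.
have xn0 : 0 < x * n%:R by rewrite mulr_gt0.
(* The total exponent is [4 * x * n - 10 * x * n]; [- x * n] is enough, because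
   [expR (x * n) >= 1 + x * n >= eps^-1]. *)
apply: (@le_trans _ _ (expR (- (x * n%:R)))); first by rewrite ler_expR; lra.
rewrite expRN -[leRHS]invrK lef_pV2 ?posrE ?expR_gt0 ?invr_gt0 //.
apply: le_trans (expR_ge1Dx _).
have : (x * eps)^-1 <= n%:R by rewrite /M in nMr; lra.
rewrite invfM => /(ler_wpM2l (ltW x0)); rewrite mulVKf ?gt_eqF //.
by lra.
Qed.
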